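(* $\mathrm{cof}(\mathcal{N})\le\max\{\mathrm{cov}(\mathcal{R}),\mathfrak{d}\}$.
   Context: $\mathcal{N}$ is the ideal of Lebesgue null sets, $\mathrm{cof}(\mathcal{N})$ its cofinality, and $\mathfrak{d}$ the dominating number. Subsets of $\omega$ are identified with elements of $2^\omega$; a natural number $n$ is identified with $\{0,\dots,n-1\}$. For distinct $x,y\in2^\omega$ let $h(x,y)=\min\{n:x(n)\ne y(n)\}$; $H(X)=\{h(x,y):x,y\in X,x\ne y\}$. The Raisonnier filter $\mathcal{F}_X$ of $X\subseteq2^\omega$ is the set of $a\subseteq\omega$ such that there are $Y_n\subseteq 2^\omega$ ($n<\omega$) with $X\subseteq\bigcup_nY_n$ and $a\supseteq\bigcup_nH(Y_n)$. A filter $\mathcal{F}$ on $\omega$ is rapid if for every increasing $f\in\omega^\omega$ there is $a\in\mathcal{F}$ with $|a\cap f(n)|\le n$ for all $n$; the trivial filter $\mathcal{P}(\omega)$ is also considered rapid. $\mathcal{R}=\{X\subseteq2^\omega:\mathcal{F}_X\text{ is rapid}\}$, and $\mathrm{cov}(\mathcal{R})$ is the least cardinality of a family of members of $\mathcal{R}$ whose union is $2^\omega$. *)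

(* Defs.v *)
From HB Require Import structures.
From mathcomp Require Import all_boot all_order all_algebra.
From mathcomp Require Import all_classical all_reals all_analysis.

Set Implicit Arguments.
Unset Strict Implicit.
Unset Printing Implicit Defensive.

Local Open Scope classical_set_scope.
Local Open Scope card_scope.

(** Cardinals are represented by sets, compared with [#<=]. *)

(* A member of [F] of least cardinality; it exists as soon as [F] is nonempty,
   see [cardminP]. *)
Definition cardmin (T : Type) (F : set (set T)) : set T :=
  xget set0 [set A | F A /\ forall B, F B -> A #<= B].

Definition cardmax (T U : Type) (A : set T) (B : set U) : set (T + U) :=
  if A #<= B then inr @` B else inl @` A.

Lemma cardminP (T : Type) (F : set (set T)) : F !=set0 ->
  F (cardmin F) /\ forall B, F B -> cardmin F #<= B.
Proof.
move=> [F0 FF0].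
apply: (@xgetPex _ set0 [set A | F A /\ forall B, F B -> A #<= B]).
have [F_0|F_n0] := pselect (F set0); first by exists set0; split.
(* Zorn on the sets of choice functions of [F] that are pairwise different
   everywhere on [F] *)
pose P (M : set (set T -> T)) := (forall m, M m -> forall A, F A -> A (m A)) /\
  (forall A, F A -> set_inj M (fun m => m A)).
have [|M [[MF Minj] Mmax]] := @Zorn_bigcup _ P.
  move=> G GP Gtot; split=> [m [M GM Mm]|A FA m n].
    by have [+ _] := GP _ GM; exact.
  rewrite !inE => -[M GM Mm] [N GN Nn].
  have [MN|NM] := Gtot _ _ GM GN.
    by have [_ +] := GP _ GN; apply=> //; rewrite inE //; apply: MN.
  by have [_ +] := GP _ GM; apply=> //; rewrite inE //; apply: NM.
suff [A [FA AM]] : exists A, F A /\ A `<=` (fun m => m A) @` M.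
  exists A; split=> // B FB; apply: card_le_trans (subset_card_le AM) _.
  apply: card_le_trans (card_image_le _ _) _.
  have /card_eqPle[_ /card_le_trans] := inj_card_eq (Minj B FB).
  apply; apply: subset_card_le => _ [m Mm <-]; exact: (MF m Mm B FB).
apply: contrapT => nA.
have /choice[m0 m0P] A : exists x, F A -> A x /\ forall m, M m -> m A <> x.
  have [FA|nFA] := pselect (F A); last first.
    have [F0_0|/set0P[x _]] := eqVneq F0 set0; last by exists x.
    by case: F_n0; rewrite -F0_0.
  have [x Ax nx] : exists2 x, A x & ~ ((fun m => m A) @` M) x.
    apply: contrapT => nx; apply: nA; exists A; split=> // x Ax.
    by apply: contrapT => nMx; apply: nx; exists x.
  by exists x => _; split=> // m Mm mx; apply: nx; exists m.
apply: (Mmax (m0 |` M)).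
  split; first by move=> m Mm; right.
  by move=> /(_ m0 (or_introl erefl)) /(m0P F0 FF0).2.
split=> [m [->|Mm] A FA|A FA m n]; [exact: (m0P A FA).1|exact: (MF m Mm A FA)|].
rewrite !inE => -[->|Mm] [->|Mn] // e.
- by case: ((m0P A FA).2 _ Mn).
- by case: ((m0P A FA).2 _ Mm).
- by apply: (Minj A FA) => //; rewrite inE.
Qed.

Lemma card_le_total (T U : Type) (A : set T) (B : set U) :
  A #<= B \/ B #<= A.
Proof.
have iA : @inl T U @` A #= A by apply: inj_card_eq => x y _ _ [].
have iB : @inr T U @` B #= B by apply: inj_card_eq => x y _ _ [].
rewrite -(card_le_eql iA) -(card_le_eqr iB).
rewrite -(card_le_eql iB) -(card_le_eqr iA).
have [|mF mle] := @cardminP _ [set inl @` A; inr @` B : set (T + U)].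
  by exists (inl @` A); left.
by case: mF mle => -> mle; [left|right]; apply: mle; [right|left].
Qed.

Lemma cardmaxP (T U V : Type) (A : set T) (B : set U) (C : set V) :
  C #<= cardmax A B <-> C #<= A \/ C #<= B.
Proof.
have iA : @inl T U @` A #= A by apply: inj_card_eq => x y _ _ [].
have iB : @inr T U @` B #= B by apply: inj_card_eq => x y _ _ [].
rewrite /cardmax; case: ifPn => AB.
  rewrite (card_le_eqr iB); split; first by right.
  by case=> // /card_le_trans; apply.
rewrite (card_le_eqr iA); split; first by left.
case=> // /card_le_trans; apply.
by case: (card_le_total A B) => // AB'; rewrite AB' in AB.
Qed.

Definition null_ideal (R : realType) : set (set R) :=
  (@lebesgue_measure R).-negligible.
Arguments null_ideal : clear implicits.

Definition cofinal_null (R : realType) : set (set (set R)) :=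
  [set C | C `<=` null_ideal R /\
           forall A, null_ideal R A -> exists2 B, C B & A `<=` B].
Arguments cofinal_null : clear implicits.

Definition cof_null (R : realType) : set (set R) := cardmin (cofinal_null R).
Arguments cof_null : clear implicits.

Definition dominating : set (set (nat -> nat)) :=
  [set D | forall f : nat -> nat,
     exists2 g, D g & \forall n \near \oo, (f n <= g n)%N].

Definition dominating_number : set (nat -> nat) := cardmin dominating.

Definition cantor := nat -> bool.

Definition first_diffs (X : set cantor) : set nat :=
  [set n | exists x y, [/\ X x, X y, x <> y &
    @first_diff (fun=> bool) x y = Some n]].

Definition raisonnier (X : set cantor) : set (set nat) :=
  [set a | exists Y : nat -> set cantor,
     X `<=` \bigcup_n Y n /\ \bigcup_n first_diffs (Y n) `<=` a].

(* [Filter] does not require properness, so the trivial filter is rapid. *)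
Definition rapid (F : set (set nat)) : Prop :=
  Filter F /\
  forall f : nat -> nat, {homo f : m n / (m < n)%N} ->
    exists2 a, F a & forall n, a `&` `I_(f n) #<= `I_n.

Definition rapid_raisonnier : set (set cantor) :=
  [set X | rapid (raisonnier X)].

Definition covering_rapid : set (set (set cantor)) :=
  [set C | C `<=` rapid_raisonnier /\ \bigcup_(X in C) X = setT].

Definition cov_rapid : set (set cantor) := cardmin covering_rapid.

Lemma raisonnier_filter (X : set cantor) : Filter (raisonnier X).
Proof.
split.
- by exists (fun=> X); split=> // x Xx; exists 0.
- move=> a b [Y [XY Ya]] [Z [XZ Zb]].
  pose c k := odflt (0, 0) (@choice.unpickle (nat * nat)%type k).
  exists (fun k => Y (c k).1 `&` Z (c k).2); split.
    move=> x Xx; have [i _ Yi] := XY _ Xx; have [j _ Zj] := XZ _ Xx.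
    by exists (choice.pickle (i, j)) => //=; rewrite /c choice.pickleK.
  move=> n [k _ [x [y [[Yx Zx] [Yy Zy] xy xyn]]]]; split.
    by apply: Ya; exists (c k).1 => //; exists x, y.
  by apply: Zb; exists (c k).2 => //; exists x, y.
- move=> a b ab [Y [XY Ya]]; exists Y; split=> //; exact: subset_trans ab.
Qed.

Lemma cof_nullP (R : realType) :
  cofinal_null R (cof_null R) /\
  forall C, cofinal_null R C -> cof_null R #<= C.
Proof.
apply: cardminP; exists (null_ideal R); split=> // A nA; by exists A.
Qed.

Lemma dominating_numberP :
  dominating dominating_number /\
  forall D, dominating D -> dominating_number #<= D.
Proof.
by apply: cardminP; exists setT => f; exists f => //; apply: nearW.
Qed.

Lemma cov_rapidP :
  covering_rapid cov_rapid /\ forall C, covering_rapid C -> cov_rapid #<= C.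
Proof.
apply: cardminP; exists [set [set x] | x in setT]; split.
  move=> _ [x _ <-]; split; first exact: raisonnier_filter.
  move=> f _; exists set0; last by move=> n; rewrite set0I.
  exists (fun=> [set x]); split; first by move=> y ->; exists 0.
  by move=> n [_ _ [y [z [/= -> -> //]]]].
by apply/seteqP; split=> // x _; exists [set x] => //; exists x.
Qed.

(* Main.v *)
(** A null set is described by a sequence [c] of elements of a countable set: it
lies in the upper limit of differences [rat_diff (c k)] of finite unions of
rational intervals, with [rat_diff (c k)] of measure at most [slalom_eps R k].
Code the sequence [c] by the point [x] of the Cantor space that is the
indicator of its graph, and let [f] from a dominating family bound the codes of
the pairs [(k, c k)].  If [x] lies in [X] with rapid Raisonnier filter, then it
lies in one of countably many sets [Y], depending only on [X] and [f], whose
first differences below [f k] are at most [k] in number.  Hence the points of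
[Y] have at most [2 ^ k] restrictions to [f k], and [c k], which is read off [x]
below [f k], takes at most [2 ^ k] values.  The upper limit of the unions of the
[rat_diff v], over these values [v], is null by Borel-Cantelli and contains the
given null set; these upper limits are indexed by the triples [(X, f, n)], of
which there are at most [max (cov_rapid, dominating_number)] because
[K * K <= K] for infinite [K]. *)

Require Import Defs.
From mathcomp Require Import all_boot all_order all_algebra.
From mathcomp Require Import all_classical all_reals all_analysis.
Import Order.TTheory GRing.Theory Num.Theory.
Import numFieldNormedType.Exports.

Set Implicit Arguments.
Unset Strict Implicit.
Unset Printing Implicit Defensive.

Local Open Scope classical_set_scope.
Local Open Scope card_scope.

(** * Injections and squares of infinite cardinals *)

Lemma card_le_inj (T U : Type) (A : set T) (B : set U) (f : T -> U) :
  set_fun A B f -> set_inj A f -> A #<= B.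
Proof.
move=> fAB fA; suff: $|{injfun A >-> B}| by case=> g; apply: inj_card_le g.
by apply/injfunPex; exists f.
Qed.

Lemma card_le_injP (T U : Type) (A : set T) (B : set U) (y : U) :
  A #<= B -> exists2 f : T -> U, set_fun A B f & set_inj A f.
Proof.
move=> /card_leP[f].
pose g x := if pselect (A x) is left h then val (f (SigSub (mem_set h))) else y.
exists g => [x Ax|x1 x2].
  by rewrite /g; case: pselect => // h; apply/set_mem/valP.
rewrite !inE /g => Ax1 Ax2; case: pselect => // h1; case: pselect => // h2 e.
by have [] := 'inj_f (mem_set I) (mem_set I) (val_inj e).
Qed.

Lemma card_leX (T T' U U' : Type) (A : set T) (A' : set T') (B : set U)
  (B' : set U') : A #<= A' -> B #<= B' -> A `*` B #<= A' `*` B'.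
Proof.
move=> AA' BB'.
have [->|/set0P[[a b] [/= Aa Bb]]] := eqVneq (A `*` B) set0.
  exact: card_ge0.
have [a' _] : A' !=set0.
  apply/set0P; apply: contraTneq AA' => ->.
  by rewrite card_le0; apply/set0P; exists a.
have [b' _] : B' !=set0.
  apply/set0P; apply: contraTneq BB' => ->.
  by rewrite card_le0; apply/set0P; exists b.
have [f fA fi] := card_le_injP a' AA'.
have [g gB gi] := card_le_injP b' BB'.
apply: (@card_le_inj _ _ _ _ (fun p => (f p.1, g p.2))).
  by move=> p [/fA ? /gB ?].
move=> [x y] [z t] /set_mem[/= Ax By] /set_mem[/= Az Bt] [] e1 e2.
by congr pair; [apply: fi|apply: gi]; rewrite ?inE.
Qed.

(* A point [x] of [X] is coded by a point of [A] together with the bit telling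
   whether [x] lies in [A]; the bit is itself coded by a point of [A]. *)
Lemma card_le_squareD (T : Type) (A X : set T) :
  [set: nat] #<= A -> A `*` A #<= A -> X `\` A #<= A -> X `*` X #<= A.
Proof.
move=> natA.
have [y0 _] : A !=set0 by apply: infinite_setN0; apply/infiniteP.
have [j jA ji] := card_le_injP y0 natA.
move=> /(card_le_injP y0)[e eA ei] /(card_le_injP y0)[h hA hi].
pose r x := if `[< A x >] then x else h x.
pose t x := j `[< A x >].
have tA x : A (t x) by exact: jA.
have rA x : X x -> A (r x).
  by rewrite /r; case: asboolP => // nAx Xx; apply: hA.
have rt x y : X x -> X y -> r x = r y -> t x = t y -> x = y.
  move=> Xx Xy; rewrite /r /t => rxy /ji; rewrite !inE => /(_ I I).
  move: rxy; case: asboolP => Ax; case: asboolP => Ay //= hxy _.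
  by apply: hi; rewrite ?inE.
have eA' a b : A a -> A b -> A (e (a, b)) by move=> Aa Ab; exact: eA.
apply: (@card_le_inj _ _ _ _
  (fun p => e (e (r p.1, r p.2), e (t p.1, t p.2)))) => [[x y] [/= Xx Xy]|].
  by apply: (eA'); apply: eA'; rewrite ?tA //; exact: rA.
move=> [x y] [z w] /set_mem[/= Xx Xy] /set_mem[/= Xz Xw].
have eE a b c d : A a -> A b -> A c -> A d -> e (a, b) = e (c, d) ->
    a = c /\ b = d.
  by move=> Aa Ab Ac Ad /ei; rewrite !inE => /(_ (conj Aa Ab) (conj Ac Ad)) [].
move=> /eE[||||]; try by apply: eA'; rewrite ?tA //; exact: rA.
move=> /eE[||||r1 r2]; try exact: rA.
move=> /eE[||||t1 t2] //.
by rewrite (rt x z) // (rt y w).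
Qed.

Section square.
Variables (T : Type) (K : set T).

(* [G] is the graph of an injection from [A `*` A] to [A]. *)
Let dom (G : set (T * T * T)) : set T := [set a | exists c, G (a, a, c)].

(** The set [A] is read off the diagonal of [G] as [dom G]; the equivalence states single-valuedness
    and injectivity together. *)
Let square_graph (G : set (T * T * T)) : Prop :=
  [/\ dom G `<=` K,
      forall p q c d, G (p, c) -> G (q, d) -> p = q <-> c = d,
      forall a b, dom G a -> dom G b -> exists c, G (a, b, c) &
      forall a b c, G (a, b, c) -> [/\ dom G a, dom G b & dom G c]].

Let dom_sub G H : G `<=` H -> dom G `<=` dom H.
Proof. by move=> GH a [c /GH]; exists c. Qed.

Let square_graph_card G : square_graph G -> dom G `*` dom G #<= dom G.
Proof.
move=> [GK Gi Gt Gd].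
have [->|/set0P[a0 _]] := eqVneq (dom G) set0; first by rewrite setX0 card_ge0.
have /choice[e eG] p : exists c, (dom G `*` dom G) p -> G (p, c).
  have [[A1 A2]|?] := pselect ((dom G `*` dom G) p); last by exists a0.
  by have [c Gc] := Gt _ _ A1 A2; exists c => _; case: p A1 A2 Gc.
apply: (@card_le_inj _ _ _ _ e) => [p /eG|p q]; first by case: p => a b /Gd[].
by rewrite !inE => /eG Gp /eG Gq; exact: (Gi _ _ _ _ Gp Gq).2.
Qed.

(** Zorn gives a maximal graph of an injection from the square of an infinite [A] in [K] to [A]. If
    the rest of [K] injects into [A], so does the square of [K]; otherwise that rest contains a copy
    of [A], onto which the graph would extend. *)
Lemma card_le_square : [set: nat] #<= K -> K `*` K #<= K.
Proof.
move=> natK.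
have [k0 _] : K !=set0 by apply: infinite_setN0; apply/infiniteP.
have [j jK ji] := card_le_injP k0 natK.
(* The pairing of natural numbers, carried to [K] by [j], is the seed that keeps the maximal graph
   infinite. *)
pose G0 : set (T * T * T) := [set p | exists m n,
  p = (j m, j n, j (choice.pickle (m, n)))].
have jI m n : j m = j n -> m = n by move=> /ji; rewrite !inE; exact.
have domG0 : dom G0 = range j.
  apply/seteqP; split=> [a [c [m [n [-> _ _]]]]|_ [m _ <-]]; first by exists m.
  by exists (j (choice.pickle (m, m))), m, m.
have sqG0 : square_graph G0.
  split; rewrite ?domG0.
  - by move=> _ [m _ <-]; exact: jK.
  - move=> p q c d [m [n [-> ->]]] [m' [n' [-> ->]]]; split=> [[/jI-> /jI->]//|].
    by move=> /jI /(pcan_inj choice.pickleK) [-> ->].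
  - move=> _ _ [m _ <-] [n _ <-].
    by exists (j (choice.pickle (m, n))), m, n.
  - by move=> a b c [m [n [-> -> ->]]]; split;
      [exists m|exists n|exists (choice.pickle (m, n))].
pose P G := square_graph G /\ (G = set0 \/ G0 `<=` G).
have [|G [[sqG GG0] Gmax]] := @Zorn_bigcup _ P.
  move=> F FP Ftot; split; last first.
    have [[H [FH H0]]|nF] := pselect (exists H, F H /\ G0 `<=` H).
      by right; apply: subset_trans H0 _; exact: bigcup_sup.
    left; apply/seteqP; split=> // p [H FH Hp]; case: nF.
    by have [_ [H0|H0]] := FP _ FH; [rewrite H0 in Hp|exists H].
  have domF a : dom (\bigcup_(H in F) H) a -> exists2 H, F H & dom H a.
    by move=> [c [H FH Hc]]; exists H => //; exists c.
  have domS H : F H -> dom H `<=` dom (\bigcup_(H in F) H).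
    by move=> FH; apply: dom_sub; exact: bigcup_sup.
  have common (Q1 Q2 : set (T * T * T) -> Prop) :
    (forall H H', H `<=` H' -> Q1 H -> Q1 H') ->
    (forall H H', H `<=` H' -> Q2 H -> Q2 H') ->
    (exists2 H, F H & Q1 H) -> (exists2 H, F H & Q2 H) ->
    exists H, [/\ F H, Q1 H & Q2 H].
    move=> m1 m2 [H FH QH] [H' FH' QH'].
    have [HH'|H'H] := Ftot _ _ FH FH'.
      by exists H'; split=> //; apply: m1 QH.
    by exists H; split=> //; apply: m2 QH'.
  split.
  - by move=> a /domF[H /FP[[HK _ _ _] _] /HK].
  - move=> p q c d [H1 F1 G1] [H2 F2 G2].
    have [||||H [FH Hp Hq]] := common (fun H => H (p, c)) (fun H => H (q, d)).
    + by move=> H H'; exact.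
    + by move=> H H'; exact.
    + by exists H1.
    + by exists H2.
    by have [[_ Hi _ _] _] := FP _ FH; exact: Hi.
  - move=> a b /domF[H1 F1 G1] /domF[H2 F2 G2].
    have [||||H [FH Ha Hb]] := common (fun H => dom H a) (fun H => dom H b).
    + by move=> H H' /dom_sub; exact.
    + by move=> H H' /dom_sub; exact.
    + by exists H1.
    + by exists H2.
    have [[_ _ Ht _] _] := FP _ FH; have [c Hc] := Ht _ _ Ha Hb.
    by exists c, H.
  - move=> a b c [H FH Hc]; have [[_ _ _ Hd] _] := FP _ FH.
    by have [? ? ?] := Hd _ _ _ Hc; split; apply: domS FH _ _.
have {}GG0 : G0 `<=` G.
  case: GG0 => // G_0; exfalso; apply: (Gmax G0); last by split=> //; right.
  rewrite G_0; split=> // /(_ (j 0, j 0, j (choice.pickle (0, 0)))); apply.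
  by exists 0, 0.
pose A := dom G.
have AA : A `*` A #<= A by exact: square_graph_card.
have natA : [set: nat] #<= A.
  apply: (@card_le_trans _ _ _ (range j)); last first.
    by apply: subset_card_le; rewrite -domG0; exact: dom_sub.
  by have /card_eqPle[] := inj_card_eq ji.
have AK : A `<=` K by case: sqG.
have [KA|] := card_le_total (K `\` A) A.
  by apply: card_le_trans (subset_card_le AK); exact: card_le_squareD KA.
move=> /(card_le_injP k0)[h hK hi]; exfalso.
pose X := A `|` h @` A.
have /(card_le_injP k0)[c cA ci] : X `*` X #<= A.
  apply: card_le_squareD => //; apply: card_le_trans (card_image_le h A).
  by apply: subset_card_le => x [[]].
(* New pairs are sent by [c] into [A], then by [h] into a copy of [A] disjoint from [A], so no old
   value is hit. *)
pose G' := G `|` [set p | X p.1.1 /\ X p.1.2 /\ ~ (A p.1.1 /\ A p.1.2) /\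
                         p.2 = h (c p.1)].
have hA x : A x -> ~ A (h x) by move=> /hK[].
have Gdom a b d : G (a, b, d) -> [/\ A a, A b & A d] by case: sqG => _ _ _; exact.
have domG' : dom G' = X.
  apply/seteqP; split=> x; first by move=> [d [/Gdom[]|/= []//]]; left.
  move=> Xx; have [Ax|nAx] := pselect (A x).
    by have [d Gd] := Ax; exists d; left.
  by exists (h (c (x, x))); right=> /=; do !split=> //; case.
apply: (Gmax G').
  split; first by move=> p; left.
  have [a Aa] : A !=set0 by apply: infinite_setN0; apply/infiniteP.
  have Xha : X (h a) by right; exists a.
  have G'h : G' (h a, h a, h (c (h a, h a))).
    by right; do !split=> //; case=> /(hA _ Aa).
  by move=> /(_ _ G'h) /Gdom[/(hA _ Aa)].
split; last by right; apply: subset_trans GG0 _ => p; left.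
have XK : X `<=` K by move=> x [/AK//|[y /hK[Ky _] <-]].
split; rewrite ?domG' //.
- have new p q d d' : G (p, d) ->
      [/\ X q.1, X q.2, ~ (A q.1 /\ A q.2) & d' = h (c q)] ->
      p = q <-> d = d'.
    case: p q => [a b] [a' b'] /Gdom[Aa Ab Ad] [/= Xa' Xb' nA' ->]; split.
      by case=> ea eb; case: nA'; rewrite -ea -eb.
    have Ac : A (c (a', b')) by exact: cA.
    by move=> dE; have := hA _ Ac; rewrite -dE.
  move=> p q d d' [Gp|[/= X1 [X2 [nA dE]]]] [Gq|[/= X1' [X2' [nA' dE']]]].
  + by case: sqG => _ Gi _ _; exact: Gi.
  + exact: new.
  + have [n1 n2] := new _ _ _ _ Gq (And4 X1 X2 nA dE).
    by split=> [/esym/n1/esym|/esym/n2/esym].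
  + rewrite dE dE'; split=> [->//|/hi].
    have cAp : A (c p) by apply: cA.
    have cAq : A (c q) by apply: cA.
    by rewrite !inE => /(_ cAp cAq) /ci; rewrite !inE; apply.
- move=> a b Xa Xb; have [[Aa Ab]|nab] := pselect (A a /\ A b).
    by case: sqG => _ _ /(_ _ _ Aa Ab) [d Gd] _; exists d; left.
  by exists (h (c (a, b))); right.
- move=> a b d [/Gdom[? ? ?]|/= [Xa [Xb [_ ->]]]]; first by split; left.
  by split=> //; right; exists (c (a, b)) => //; exact: cA.
Qed.

End square.

(** * Null sets as upper limits of coded sets *)

Section null_sets.
Variable R : realType.
Local Open Scope ring_scope.

(* [2 ^ k] sets of measure [slalom_eps k] have total measure [2 ^- (k + 1)]. *)
Definition slalom_eps (k : nat) : R := (2 ^ k * 2 ^ (k + 1))%:R^-1.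

Lemma slalom_eps_gt0 k : 0 < slalom_eps k.
Proof. by rewrite invr_gt0 ltr0n muln_gt0 !expn_gt0. Qed.

(** Borel-Cantelli: the [k]-th union has measure at most [2 ^ k * slalom_eps k], that is
    [2 ^- (k + 1)], which is summable. *)
Lemma lim_sup_slalom_null d (T : measurableType d)
    (mu : {measure set T -> \bar R}) (V : choiceType) (c : V -> set T)
    (S : nat -> set V) :
  (forall v, measurable (c v)) ->
  (forall k, S k #<= `I_(2 ^ k)) ->
  (forall k v, S k v -> (mu (c v) <= (slalom_eps k)%:E)%E) ->
  mu.-negligible (lim_sup_set (fun k => \bigcup_(v in S k) c v)).
Proof.
move=> mc cardS muS.
have finS k : finite_set (S k) by apply/finite_set_leP; exists (2 ^ k)%N.
have mS k : measurable (\bigcup_(v in S k) c v) by exact: fin_bigcup_measurable.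
exists (lim_sup_set (fun k => \bigcup_(v in S k) c v)); split=> //.
  by apply: bigcap_measurable => [|k _]; [exists 0%N|exact: bigcup_measurable].
apply: lim_sup_set_cvg0 => //.
apply: (@le_lt_trans _ _ (\sum_(k <oo) (1 / (2 ^ (k + 1))%:R)%:E)%E); last first.
  by rewrite (cvg_lim _ (@cvg_geometric_eseries_half R 1 0)) ?ltry.
apply: lee_nneseries => // k _.
rewrite (le_trans (content_sub_fsum mu (finS k) _ _ (@subset_refl _ _)))//.
apply: le_trans (lee_fsum (finS k) (muS k)) _.
rewrite fsbig_finite// sumEFin lee_fin big_const_seq count_predT iter_addr_0.
apply: (@le_trans _ _ (slalom_eps k *+ 2 ^ k)).
  rewrite -mulr_natr -[leRHS]mulr_natr ler_wpM2l ?ler_nat ?geq_card_fset_set//.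
  exact/ltW/slalom_eps_gt0.
rewrite -(mulr_natl (slalom_eps k)) /slalom_eps (natrM _ (2 ^ k) (2 ^ _)).
by rewrite invfM mulrA divff// pnatr_eq0 expn_eq0.
Qed.

Let mu : measure _ _ := @lebesgue_measure R.

Definition rat_itv (p : rat * rat) : set R := [set` `]ratr p.1, ratr p.2[].

Definition rat_union (s : seq (rat * rat)) : set R :=
  \big[setU/set0]_(p <- s) rat_itv p.

(** The type is countable, so a sequence of codes fits into a subset of [nat]. Differences serve to
    cut an open set into the increments of an exhaustion by finite unions. *)
Definition diff_code := (seq (rat * rat) * seq (rat * rat))%type.

Definition rat_diff (v : diff_code) : set R :=
  rat_union v.1 `\` rat_union v.2.

Lemma measurable_rat_union s : measurable (rat_union s).
Proof. by apply: bigsetU_measurable => p _; exact: measurable_itv. Qed.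

Lemma measurable_rat_diff v : measurable (rat_diff v).
Proof. by apply: measurableD; exact: measurable_rat_union. Qed.

Lemma open_rat_itv (U : set R) x : open U -> U x ->
  exists p, rat_itv p x /\ rat_itv p `<=` U.
Proof.
move=> oU Ux; have /nbhs_ballP[e /= e0 xeU] := oU x Ux.
have [|p /[!in_itv]/= /andP[p1 p2]] := @rat_in_itvoo R (x - e) x.
  by rewrite ltrBlDr ltrDl.
have [|q /[!in_itv]/= /andP[q1 q2]] := @rat_in_itvoo R x (x + e).
  by rewrite ltrDl.
exists (p, q); split; first by rewrite /rat_itv /= in_itv /= p2.
move=> y; rewrite /rat_itv /= in_itv /= => /andP[py yq]; apply: xeU.
rewrite ball_itv /= in_itv /= (lt_trans p1 py) (lt_trans yq q2) //.
Qed.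

Section open_pieces.
Variable U : set R.

Let stage (j : nat) : seq (rat * rat) :=
  [seq p <- pmap choice.pickle_inv (iota 0 j) | `[< rat_itv p `<=` U >]].

Let stageP j x : rat_union (stage j) x <->
  exists p, [/\ (choice.pickle p < j)%N, rat_itv p `<=` U & rat_itv p x].
Proof.
have mem p :
    (p \in stage j) = (choice.pickle p < j)%N && `[< rat_itv p `<=` U >].
  rewrite mem_filter.
  rewrite (can2_mem_pmap (@choice.pickle_invK _) (@choice.pickleK_inv _)).
  by rewrite mem_iota andbC.
rewrite /rat_union -bigcup_seq; split.
  by move=> [p /=]; rewrite mem => /andP[pj /asboolP pU] px; exists p.
by move=> [p [pj pU px]]; exists p => //=; rewrite mem pj; apply/asboolP.
Qed.

(** Finite unions of rational intervals exhaust [U], so what they leave out has measure tending to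
    0; a late enough stage bounds the increment that follows it by [e m]. *)
Lemma open_rat_diff (e : nat -> R) : open U -> (forall m, 0 < e m) ->
  (mu U <= (e 0%N)%:E)%E -> exists c : nat -> diff_code,
    (forall m, mu (rat_diff (c m)) <= (e m)%:E)%E /\
    U `<=` \bigcup_m rat_diff (c m).
Proof.
move=> oU e0 Ue.
have stage0 : rat_union (stage 0) = set0 by rewrite /rat_union /stage /= big_nil.
have mU : measurable U by exact: measurable_realfun.open_measurable.
pose D j := U `\` rat_union (stage j).
have mD j : measurable (D j).
  by apply: measurableD => //; exact: measurable_rat_union.
have capD : \bigcap_j D j = set0.
  apply/seteqP; split=> // x Dx; have [Ux _] := Dx 0%N I.
  have [p [px pU]] := open_rat_itv oU Ux.
  have [_] := Dx (choice.pickle p).+1 I; apply; apply/stageP; by exists p.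
have muD : mu (D j) @[j --> \oo] --> 0%E.
  rewrite -(@measure0 _ _ _ mu) -capD; apply: nonincreasing_cvg_mu => //.
  - by rewrite /D stage0 setD0 (le_lt_trans Ue) ?ltry.
  - by rewrite capD.
  - move=> i j ij; apply/subsetPset => x [Ux nx]; split=> //.
    move=> /stageP[p [pi pU px]].
    by apply: nx; apply/stageP; exists p; split=> //; exact: leq_trans ij.
have /choice[f fP] m : exists j, (m <= j)%N /\ (mu (D j) <= (e m)%:E)%E.
  have near_e : \forall j \near \oo, (mu (D j) <= (e m)%:E)%E.
    have e0' : (0 < (e m)%:E)%E by rewrite lte_fin.
    have near_lt : \forall j \near \oo, (mu (D j) < (e m)%:E)%E.
      exact: muD (open_ereal_lt' e0').
    by apply: filterS near_lt => j; exact: ltW.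
  have [N _ NP] := near_e; exists (maxn m N); split; first exact: leq_maxl.
  by apply: NP; rewrite /= leq_maxr.
(* Nothing precedes the first increment, so its bound [e 0] comes from the measure of [U] itself. *)
pose N m := if m is 0%N then 0%N else f m.
exists (fun m => (stage (N m.+1), stage (N m))); split=> [m|x Ux].
  apply: (@le_trans _ _ (mu (D (N m)))).
    apply: le_measure.
    - by rewrite inE; exact: measurable_rat_diff.
    - by rewrite inE; exact: mD.
    by move=> x [/stageP[p [_ pU px]] nx]; split=> //; exact: pU.
  by case: m => [|m] /=; [rewrite /D stage0 setD0|case: (fP m.+1)].
have [p [px pU]] := open_rat_itv oU Ux.
have xN : exists m, `[< rat_union (stage (N m)) x >].
  exists (choice.pickle p).+1; apply/asboolP/stageP; exists p; split=> //=.
  by case: (fP (choice.pickle p).+1).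
case: (ex_minnP xN) => -[|m] /asboolP; first by rewrite /= stage0.
move=> xm min; exists m => //; split=> //= xm'.
by have := min m (asboolT xm'); rewrite ltnn.
Qed.

End open_pieces.

(** For each [n], a small open superset of [A] is cut into pieces, the [m]-th placed at position
    [pickle (n, m)]. A point of [A] lies in a piece for every [n], hence at infinitely many
    positions. *)
Lemma null_rat_diff (A : set R) : null_ideal R A -> exists c : nat -> diff_code,
  (forall k, mu (rat_diff (c k)) <= (slalom_eps k)%:E)%E /\
  A `<=` lim_sup_set (fun k => rat_diff (c k)).
Proof.
move=> [N [mN N0 AN]].
have muN0 : mu N = 0%E by exact: N0.
have /choice[c cP] (n : nat) : exists c : nat -> diff_code,
    (forall m, mu (rat_diff (c m)) <= (slalom_eps (choice.pickle (n, m)))%:E)%E /\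
    A `<=` \bigcup_m rat_diff (c m).
  have [||U [oU NU UN]] := @lebesgue_regularity_outer R _
    (slalom_eps (choice.pickle (n, 0%N))) mN.
  - by rewrite [ltLHS]muN0 ltry.
  - exact: slalom_eps_gt0.
  have [||c [cle Uc]] := @open_rat_diff U
      (fun m => slalom_eps (choice.pickle (n, m))) oU.
  - by move=> m; exact: slalom_eps_gt0.
  - have mU : measurable U by exact: measurable_realfun.open_measurable.
    rewrite (@measureDI _ _ _ mu U N) // [X in (_ + X)%E](_ : _ = 0%E).
      by rewrite adde0 ltW.
    by apply: (subset_measure0 _ _ _ muN0) => //; exact: measurableI.
  by exists c; split=> // x /AN /NU /Uc.
pose d k := if choice.pickle_inv k is Some p then c p.1 p.2 else ([::], [::]).
have d0 : rat_diff ([::], [::]) = set0.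
  by rewrite /rat_diff /rat_union /= big_nil set0D.
exists d; split=> [k|x Ax M _].
  rewrite /d; have := @choice.pickle_invK (nat * nat)%type k.
  case: (choice.pickle_inv k).
    by move=> [n m] /= <-; have [+ _] := cP n; apply.
  by move=> _; rewrite d0 measure0 lee_fin ltW // slalom_eps_gt0.
pose m n := xget 0%N [set m | rat_diff (c n m) x].
have mP n : rat_diff (c n (m n)) x.
  have [_ /(_ _ Ax) [i _ ?]] := cP n.
  by apply: (@xgetPex _ 0%N [set m | rat_diff (c n m) x]); exists i.
have [|n Mn] := @injective_gtn (fun n => choice.pickle (n, m n)) _ M.
  by move=> i j /(pcan_inj choice.pickleK) [].
exists (choice.pickle (n, m n)); first exact: ltnW.
by rewrite /d choice.pickleK_inv.
Qed.

End null_sets.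

(** * Slaloms from Raisonnier filters *)

(* Two points of [Y] that agree on [a] below [m] agree below [m], since [a]
   contains their first difference. *)
Lemma first_diffs_prefix (Y : set cantor) (a : set nat) (m k : nat) :
  first_diffs Y `<=` a -> a `&` `I_m #<= `I_k ->
  exists t : cantor -> {ffun 'I_k -> bool}, forall x y, Y x -> Y y ->
    t x = t y -> forall i, (i < m)%N -> x i = y i.
Proof.
move=> Ya /(card_le_injP 0)[e ek ei].
(* The bit of [x] at a point [j] of [a] below [m] is stored in place [e j]. *)
exists (fun x => [ffun i : 'I_k =>
  `[< exists j, [/\ (a `&` `I_m) j, e j = i & x j] >]]) => x y Yx Yy txy i im.
case exy : (@first_diff (fun=> bool) x y) => [n|]; last first.
  by have /first_diff_NoneP -> := exy.
have /first_diff_SomeP[pxy nxy] := exy.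
have [in_|ni] := ltnP i n; first exact: pxy.
have nm : (n < m)%N by exact: leq_ltn_trans im.
have an : (a `&` `I_m) n.
  split=> //; apply: Ya; exists x, y; split=> // xy.
  by rewrite xy eqxx in nxy.
have tE (z : cantor) : [ffun i : 'I_k =>
    `[< exists j, [/\ (a `&` `I_m) j, e j = i & z j] >]] (Ordinal (ek n an)) = z n.
  rewrite ffunE /=; apply/asboolP/idP => [[j [aj /ei]]|zn]; last by exists n.
  by rewrite !inE => /(_ aj an) ->.
by rewrite -(tE x) -(tE y) txy eqxx in nxy.
Qed.

Definition graph_code (V : countType) (g : nat -> V) : cantor := fun m =>
  if choice.pickle_inv m is Some p then g p.1 == p.2 else false.

(** The bound on the code of [(k, v)] puts the bit of the graph that witnesses [g k = v] below
    [f k]. *)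
Definition slalom (V : countType) (Y : set cantor) (f : nat -> nat) (k : nat) :
  set V :=
  [set v | exists g, [/\ Y (graph_code g), g k = v &
                         (choice.pickle (k, v) < f k)%N]].
Arguments slalom : clear implicits.

Lemma card_slalom (V : countType) (Y : set cantor) (a : set nat)
    (f : nat -> nat) (k : nat) :
  first_diffs Y `<=` a -> a `&` `I_(f k) #<= `I_k ->
  slalom V Y f k #<= `I_(2 ^ k).
Proof.
move=> Ya /(first_diffs_prefix Ya)[t tP].
have /choice[G GP] v : exists g : nat -> V, slalom V Y f k v ->
    [/\ Y (graph_code g), g k = v & (choice.pickle (k, v) < f k)%N].
  have [[g ?]|] := pselect (slalom V Y f k v); first by exists g.
  by exists (fun=> v).
apply: (@card_le_inj _ _ _ _ (fun v => enum_rank (t (graph_code (G v))) : nat)).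
  move=> v _ /=; rewrite (leq_trans (ltn_ord _))//.
  by rewrite card_ffun card_bool card_ord.
move=> v w /set_mem/GP[Yv Gv vf] /set_mem/GP[Yw Gw wf] /val_inj/enum_rank_inj.
move=> /tP-/(_ Yv Yw _ vf); rewrite /graph_code !choice.pickleK_inv /= Gv eqxx.
by move=> /esym/eqP <-.
Qed.

(** * Dominating functions and the final count *)

(** One plus the sum of a finite family exceeds every member everywhere. This makes the cardinal
    bound in the theorem infinite. *)
Lemma infinite_dominating (D : set (nat -> nat)) :
  dominating D -> infinite_set D.
Proof.
move=> domD /finite_seqP[s Ds].
have [g Dg [N _ Ng]] := domD (fun n => (\sum_(h <- s) h n).+1).
have := Ng N (leqnn N); rewrite /= ltnNge (big_rem g) /= ?leq_addr//.
by rewrite Ds in Dg.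
Qed.

(** Summing successors gives a strictly increasing function, as rapidity demands, strictly above
    [f], as the bound in [slalom] demands. *)
Definition increasing_majorant (f : nat -> nat) (n : nat) : nat :=
  \sum_(i < n.+1) (f i).+1.

Lemma increasing_majorant_homo f :
  {homo increasing_majorant f : m n / (m < n)%N}.
Proof.
apply: homo_ltn; first exact: ltn_trans.
by move=> n; rewrite /increasing_majorant [ltnRHS]big_ord_recr /= -addn1 leq_add.
Qed.

Lemma increasing_majorant_gt f n : (f n < increasing_majorant f n)%N.
Proof. by rewrite /increasing_majorant big_ord_recr leq_addl. Qed.

Lemma rapid_slaloms (V : countType) (X : set cantor) (f : nat -> nat) :
  rapid_raisonnier X -> exists Y : nat -> set cantor,
    X `<=` \bigcup_n Y n /\
    forall n k, slalom V (Y n) (increasing_majorant f) k #<= `I_(2 ^ k).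
Proof.
move=> [_ /(_ _ (@increasing_majorant_homo f))[a [Y [XY Ya]] af]].
exists Y; split=> // n k; apply: card_slalom (af k).
by move=> i Yi; apply: Ya; exists n.
Qed.

Theorem theorem6p7 (R : realType) :
  cof_null R #<= cardmax cov_rapid dominating_number.
Proof.
have [[covR covT] _] := cov_rapidP.
have [dom _] := dominating_numberP.
have [_ cof_min] := cof_nullP R.
pose V := diff_code.
have /choice[Y YP] (p : set cantor * (nat -> nat)) : exists Y : nat -> set cantor,
    rapid_raisonnier p.1 -> p.1 `<=` \bigcup_n Y n /\
    forall n k, slalom V (Y n) (increasing_majorant p.2) k #<= `I_(2 ^ k).
  have [/(rapid_slaloms V p.2)[Z ?]|?] := pselect (rapid_raisonnier p.1).
    by exists Z.
  by exists (fun=> set0).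
(* Discarding codes of large measure makes [Z] null at every triple in [I] and loses no [c k]. *)
pose S p n k := slalom V (Y p n) (increasing_majorant p.2) k `&`
  [set v | (@lebesgue_measure R (rat_diff v) <= (slalom_eps R k)%:E)%E].
pose Z (q : set cantor * (nat -> nat) * nat) : set R :=
  lim_sup_set (fun k => \bigcup_(v in S q.1 q.2 k) rat_diff v).
pose I := cov_rapid `*` dominating_number `*` [set: nat].
have cofZ : cofinal_null R (Z @` I).
  split=> [_ [[[X f] n] [[/= /covR Xr _] _] <-]|A /null_rat_diff[c [muc Ac]]].
    apply: lim_sup_slalom_null => [v|k|k v []//].
      exact: measurable_rat_diff.
    have [_ /(_ n k)] := YP (X, f) Xr; apply: card_le_trans.
    by apply: subset_card_le => v [].
  have [X CX Xc] : (\bigcup_(X in cov_rapid) X) (graph_code c) by rewrite covT.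
  have [f Df [N _ cf]] := dom (fun k => choice.pickle (k, c k)).
  have [/(_ _ Xc)[n _ Yn] _] := YP (X, f) (covR _ CX).
  exists (Z (X, f, n)); first by exists (X, f, n).
  (* The index [k] is taken beyond [N] as well, where [f] bounds the code of [(k, c k)]. *)
  move=> x Ax M _; have [k kMN xk] := Ac x Ax (maxn M N) Logic.I.
  move: kMN; rewrite /= geq_max => /andP[Mk Nk].
  exists k => //; exists (c k) => //; split; last exact: muc.
  exists c; split=> //; apply: leq_ltn_trans (cf k Nk) _.
  exact: increasing_majorant_gt.
apply: card_le_trans (cof_min _ cofZ) _.
apply: card_le_trans (card_image_le _ _) _.
set K := cardmax _ _.
have [covK domK] : cov_rapid #<= K /\ dominating_number #<= K.
  by split; apply/cardmaxP; [left|right]; exact: card_lexx.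
have natK : [set: nat] #<= K.
  by apply: card_le_trans domK; apply/infiniteP; exact: infinite_dominating.
have KK : K `*` K #<= K by exact: card_le_square.
apply: card_le_trans KK; apply: (card_leX _ natK).
by apply: card_le_trans (card_le_square natK); exact: card_leX.
Qed.
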